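(* Let $n,m\ge1$ with $nm=2$ and let $\varepsilon>0$. For every sequence of balls $\Psi=(B_q)_{q\in\mathbb{N}}$ in $\mathbb{R}^m/\mathbb{Z}^m$, \[ |\mathcal{A}_{n,m}(\Psi)|=1\quad\text{if}\quad\sum_{q=1}^\infty q^{n-1}\Bigl(\frac{\varphi(q)}{q}\Bigr)^{1+\varepsilon}|B_q|=\infty . \]
   Context: $\varphi$ is Euler's totient function. For $\mathbf{q}\in\mathbb{Z}^n$, $|\mathbf{q}|=\max_i|q_i|$. Balls are max-norm balls in $\mathbb{R}^m/\mathbb{Z}^m$; $|\cdot|$ is Lebesgue measure. Points $\mathbf{x}\in[0,1]^{nm}$ are $n\times m$ matrices and $\mathbf{q}\mathbf{x}$ is the row-vector–matrix product. $\mathcal{A}_{n,m}(\Psi)$ is the set of $\mathbf{x}\in[0,1]^{nm}$ such that $\mathbf{q}\mathbf{x}+\mathbf{p}\in B_{|\mathbf{q}|}$ for infinitely many $(\mathbf{p},\mathbf{q})\in\mathbb{Z}^m\times(\mathbb{Z}^n\setminus\{\mathbf0\})$. *)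

(* Defs.v *)
From HB Require Import structures.
From mathcomp Require Import all_boot all_order all_algebra.
From mathcomp Require Import all_classical all_reals all_analysis.
Import Order.TTheory GRing.Theory Num.Theory.
Local Open Scope ring_scope.
Local Open Scope classical_set_scope.

Definition supnorm_int {n : nat} (q : 'rV[int]_n) : nat :=
  \max_(i < n) `|q ord0 i|%N.

Section Defs.
Context {R : realType}.

(* A ball B = B(c, r) of R^m/Z^m (max norm), represented by its lift
   {y in R^m : max_j |y_j - c_j| < r}; "q x + p in B" is read in R^m. *)
Definition in_maxball {m : nat} (c : 'rV[R]_m) (r : R) (y : 'rV[R]_m) : Prop :=
  forall j : 'I_m, `|y ord0 j - c ord0 j| < r.

(* Lebesgue (Haar) measure of the ball of radius r > 0 in the torus R^m/Z^m
   for the max norm: (min(2r, 1))^m. *)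
Definition torus_ball_vol (m : nat) (r : R) : R := (Num.min (2 * r) 1) ^+ m.

Definition approx_set (n m : nat) (c : nat -> 'rV[R]_m) (r : nat -> R)
  : set 'M[R]_(n, m) :=
  [set X : 'M[R]_(n, m) | (forall i j, 0 <= X i j <= 1) /\
     infinite_set [set pq : 'rV[int]_m * 'rV[int]_n |
        (pq.2 != 0)%R /\
        in_maxball (c (supnorm_int pq.2)) (r (supnorm_int pq.2))
          (map_mx intr pq.2 *m X + map_mx intr pq.1)]].

(* Identification of R^2 with n x m matrices when n * m = 2:
   entry (0,0) is z.1 and the other entry is z.2. *)
Definition mat_of_pair (n m : nat) (z : R * R) : 'M[R]_(n, m) :=
  \matrix_(i < n, j < m) (if (i + j == 0)%N then z.1 else z.2).

Definition lebesgue2 := ((@lebesgue_measure R) \x (@lebesgue_measure R))%E.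

End Defs.

(* Main.v *)
(** Both cases reduce to a divergence Borel-Cantelli lemma: if the weighted
    counting function S_N has mean M_N -> oo and second moment at most
    (1 + eta) M_N^2 + C_eta M_N for every eta > 0, then S_N -> oo almost surely,
    by Chebyshev's inequality.

    For (n, m) = (2, 1), keep only the vectors (k, q) with 0 <= k < q coprime
    to q.  Distinct ones are linearly independent, so the corresponding events
    are pairwise independent, and their total mass is the sum of phi(q) |B_q|.

    For (n, m) = (1, 2), give the event of q the weight phi(q)/q.  With
    delta = |B_q|^(1/2), delta' = |B_q'|^(1/2) and g = gcd(q, q'), averaging over
    translations by multiples of 1/q bounds the overlap in each coordinate by
    delta delta' + delta g/q.  For q' <= q the error terms delta^2 g^2/q^2 are
    summable against the weights because the sum over q' <= q of
    (phi(q')/q') g^2 is at most the sum over d | q of phi(d) d (q/d) = q^2. *)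

Require Import Defs.
From HB Require Import structures.
From mathcomp Require Import all_boot all_order all_algebra.
From mathcomp Require Import all_solvable.
From mathcomp Require Import all_classical all_reals all_analysis.
From mathcomp Require Import measurable_realfun.
From mathcomp Require Import zify ring lra.
Import Order.TTheory GRing.Theory Num.Theory.
Local Open Scope ring_scope.
Local Open Scope classical_set_scope.

(** * Totient sums *)

(** Residues coprime to [g] repeat in each of [e] blocks of length [g], so [totient g * e] numbers
    below [g * e] are coprime to [g]; coprimality to [g * e] is a stronger condition. *)
Lemma totient_mul_le (g e : nat) : (totient (g * e) <= totient g * e)%N.
Proof.
have count_coprime k : (\sum_(0 <= x < g * k) coprime g x = totient g * k)%N.
  elim: k => [|k IHk]; first by rewrite !muln0 big_nil.
  rewrite mulnS addnC (@big_cat_nat _ _ _ (g * k)%N) ?leq_addr //= IHk mulnS addnC.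
  congr (_ + _)%N; rewrite totient_count_coprime -[X in index_iota X _]add0n.
  rewrite big_addn addKn; apply: eq_bigr => i _.
  by rewrite /coprime addnC mulnC gcdnMDl.
rewrite totient_count_coprime -count_coprime; apply: leq_sum => x _.
by rewrite coprimeMl; case: (coprime g x) => //=; case: coprime.
Qed.

(** The term for [k] is one of the summands [d * totient d] over the common divisors [d] of [k] and
    [q]. After exchanging the sums, each [d] occurs [q %/ d] times, and the totients of the divisors
    of [q] add up to [q]. *)
Lemma sum_gcd_totient_le (q : nat) :
  (\sum_(1 <= k < q.+1) gcdn k q * totient (gcdn k q) <= q ^ 2)%N.
Proof.
have [->|q0] := posnP q; first by rewrite big_geq.
apply: (@leq_trans (\sum_(1 <= k < q.+1) \sum_(d < q.+1 | (d %| q)%N)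
    (d %| k) * (d * totient d))%N).
  rewrite big_seq [leqRHS]big_seq; apply: leq_sum => k.
  rewrite mem_index_iota => /andP[k0 kq].
  have gq : (gcdn k q < q.+1)%N by rewrite ltnS dvdn_leq // dvdn_gcdr.
  rewrite (bigD1 (Ordinal gq)) /= ?dvdn_gcdr // dvdn_gcdl mul1n leq_addr //.
rewrite exchange_big /= -[X in (_ <= X ^ 2)%N](sum_totient_dvd q).
rewrite -mulnn big_distrr /=; apply: leq_sum => d dq.
by rewrite -big_distrl /= -divn_count_dvd mulnA divnK // sum_totient_dvd.
Qed.

Lemma totient_ratio_dvd (R : realType) (g k : nat) : (0 < k)%N -> (g %| k)%N ->
  ((totient k)%:R / k%:R <= (totient g)%:R / g%:R :> R).
Proof.
move=> k0 gk; have g0 : (0 < g)%N by rewrite (dvdn_gt0 k0).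
rewrite ler_pdivrMr ?ltr0n // mulrAC ler_pdivlMr ?ltr0n // -!natrM ler_nat.
case/dvdnP: gk k0 => e -> _; rewrite mulnC [(e * g)%N]mulnC.
by rewrite -(mulnCA g) leq_mul2l totient_mul_le orbT.
Qed.

Lemma totient_ratio_le1 (R : realType) (k : nat) : (totient k)%:R / k%:R <= 1 :> R.
Proof.
have [->|k0] := posnP k; first by rewrite invr0 mulr0.
by have := @totient_ratio_dvd R _ _ k0 (dvd1n k); rewrite (_ : totient 1 = 1%N) // divr1.
Qed.

(** Since g = [gcdn k q] divides [k], [totient_ratio_dvd] replaces phi(k)/k by phi(g)/g, which turns
    each term into g phi(g). *)
Lemma sum_gcd_sqr_le (R : realType) (q : nat) :
  \sum_(1 <= k < q.+1) (totient k)%:R / k%:R * (gcdn k q)%:R ^+ 2 <= q%:R ^+ 2 :> R.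
Proof.
have := sum_gcd_totient_le q; rewrite -(ler_nat R) natrX; apply: le_trans.
rewrite natr_sum big_seq [leRHS]big_seq; apply: ler_sum => k.
rewrite mem_index_iota => /andP[k0 _].
have g0 : (0 < gcdn k q)%N by rewrite gcdn_gt0 k0.
have := @totient_ratio_dvd R _ _ k0 (dvdn_gcdl k q).
  move=> /(ler_wpM2r (sqr_ge0 (gcdn k q)%:R)) /le_trans; apply.
  by rewrite natrM expr2 mulrA divfK ?pnatr_eq0 ?gt_eqF // mulrC.
Qed.

(** * Periodic functions on the unit interval *)

Lemma lebesgue_measureD (R : realType) (s : R) (A : set R) : measurable A ->
  pushforward lebesgue_measure
    ((fun x => x + s) : measurableTypeR R -> measurableTypeR R) A
  = lebesgue_measure A.
Proof.
have mD : measurable_fun setT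
    ((fun x => x + s) : measurableTypeR R -> measurableTypeR R).
  exact: measurable_funD.
move=> mA; apply/esym/lebesgue_measure_unique => //= _ [[a b]] _ <-.
rewrite /pushforward (_ : _ @^-1` _ = `]a - s, b - s]%classic).
  rewrite !lebesgue_measure_itv/= !lte_fin ltrD2r; case: ifPn => // _.
  by rewrite -!EFinB; congr (_ %:E); ring.
by apply/seteqP; split => x /=; rewrite !in_itv /= ltrBlDr lerBrDr.
Qed.

Lemma indic_congr (R : pzRingType) (T T' : Type) (A : set T) (B : set T') x y :
  (A x <-> B y) -> \1_A x = \1_B y :> R.
Proof.
move=> AB; rewrite !indicE; congr ((nat_of_bool _)%:R).
by apply/idP/idP; rewrite !inE => /AB.
Qed.

Lemma periodic_int (R : realType) (T : Type) (f : R -> T) :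
  (forall x, f (x + 1) = f x) -> forall x (p : int), f (x + p%:~R) = f x.
Proof.
move=> f1 x p.
have fn y (n : nat) : f (y + n%:R) = f y.
  elim: n => [|n IHn]; first by rewrite addr0.
  by rewrite -natr1 addrA f1.
case: p => n; first by rewrite -pmulrn fn.
by rewrite NegzE mulrNz -pmulrn -[LHS](fn _ n.+1) subrK.
Qed.

Section UnitInterval.
Context {R : realType}.
Local Open Scope ereal_scope.

(** Stands for the Haar measure of the circle, carried by a fundamental domain. *)
Definition unit_prob := uniform_prob (@ltr01 R).
HB.instance Definition _ := Probability.on unit_prob.

Local Notation U := unit_prob.

Lemma integral_unit_cst (k : \bar R) : \int[U]_x k = k.
Proof.
rewrite integral_cst //. transitivity (k * 1); last by rewrite mule1.
by congr (_ * _); exact: (probability_setT unit_prob).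
Qed.

(** The half-open interval can be cut into disjoint half-open pieces that are then translated. *)
Lemma integral_unit_prob (f : R -> \bar R) :
  measurable_fun setT f -> (forall x, 0 <= f x) ->
  \int[U]_x f x = \int[lebesgue_measure]_(x in `[0%R, 1%R[) f x.
Proof.
move=> mf f0; rewrite integral_uniform // subr0 invr1 mul1e.
by rewrite integral_itv_bndo_bndc //; exact: measurable_funTS.
Qed.

Lemma integral_lebesgue_shift (s a b : R) (f : R -> \bar R) :
  measurable_fun setT f -> (forall x, 0 <= f x) ->
  \int[lebesgue_measure]_(x in `[a, b[) f (x + s)%R =
  \int[lebesgue_measure]_(x in `[(a + s)%R, (b + s)%R[) f x.
Proof.
move=> mf f0.
have mD : measurable_fun setT
    ((fun x => x + s)%R : measurableTypeR R -> measurableTypeR R).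
  exact: measurable_funD.
transitivity (\int[pushforward lebesgue_measure
    ((fun x => x + s)%R : measurableTypeR R -> measurableTypeR R)]_(x in
    `[(a + s)%R, (b + s)%R[) f x); last first.
  by apply: eq_measure_integral => //= A mA _; exact: lebesgue_measureD.
rewrite ge0_integral_pushforward //; last exact: measurable_funTS.
congr (integral _ _ _).
by apply/seteqP; split => x /=; rewrite !in_itv /= lerD2r ltrD2r.
Qed.

(** By periodicity only the fractional part [t] of [s] matters. The translated domain [t, 1 + t) is
    cut at 1, and the piece beyond 1 is moved back to [0, t). *)
Lemma integral_unit_shift (s : R) (f : R -> \bar R) :
  measurable_fun setT f -> (forall x, 0 <= f x) ->
  (forall x, f (x + 1)%R = f x) ->
  \int[U]_x f (x + s)%R = \int[U]_x f x.
Proof.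
move=> mf f0 f1.
have fz x (p : int) : f (x + p%:~R)%R = f x by exact: periodic_int.
have mfs : measurable_fun setT (fun x : R => f (x + s)%R).
  by apply: measurableT_comp => //; exact: measurable_funD.
pose t := (s - (Num.floor s)%:~R)%R.
have t0 : (0 <= t)%R by rewrite subr_ge0 floor_le.
have t1 : (t < 1)%R by rewrite ltrBlDl; have := floorD1_gt s; rewrite intrD.
have -> : (fun x : R => f (x + s)%R) = (fun x => f (x + t)%R).
  by apply/funext => x; rewrite /t addrA -mulrNz fz.
have mft : measurable_fun setT (fun x : R => f (x + t)%R).
  by apply: measurableT_comp => //; exact: measurable_funD.
rewrite !integral_unit_prob // integral_lebesgue_shift // add0r.
have split2 (a b c : R) : (a <= b)%R -> (b <= c)%R ->
    \int[lebesgue_measure]_(x in `[a, c[) f x =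
    \int[lebesgue_measure]_(x in `[a, b[) f x +
    \int[lebesgue_measure]_(x in `[b, c[) f x.
  move=> ab bc; rewrite -ge0_integral_setU //.
  - by rewrite -itv_bndbnd_setU ?bnd_simp.
  - exact: measurable_funTS.
  - by rewrite disj_set2E; apply/eqP/seteqP; split => // x /= [];
      rewrite !in_itv /= => /andP[_ xb] /andP[bx _]; lra.
rewrite (split2 t 1%R (1 + t)%R) ?(split2 0%R t 1%R) //; [|lra..].
rewrite addeC; congr (_ + _)%E.
have := @integral_lebesgue_shift 1%R 0%R t f mf f0.
rewrite add0r (addrC t) => <-.
by apply: eq_integral => x _; rewrite f1.
Qed.

(** Translating t by (s - u)/D shows that the left side is the same for every offset s in place of
    [u]. Averaging over s and exchanging the integrals leaves translates of [f], which all have the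
    same integral. *)
Lemma integral_unit_dilate (D : int) (u : R) (f : R -> \bar R) : D != 0%R ->
  measurable_fun setT f -> (forall x, 0 <= f x) ->
  (forall x, f (x + 1)%R = f x) ->
  \int[U]_t f (u + D%:~R * t)%R = \int[U]_t f t.
Proof.
move=> D0 mf f0 f1.
have fz x (p : int) : f (x + p%:~R)%R = f x by exact: periodic_int.
have mfu v : measurable_fun setT (fun t : R => f (v + D%:~R * t)%R).
  by apply: measurableT_comp => //; exact: measurable_funD.
have shift s : \int[U]_t f (u + D%:~R * t)%R = \int[U]_t f (s + D%:~R * t)%R.
  rewrite -(@integral_unit_shift ((s - u) / D%:~R) (fun t => f (u + D%:~R * t)%R)) //.
  - apply: eq_integral => t _; congr f.
    by rewrite mulrDr mulrCA divff ?mulr1 ?intr_eq0 //; ring.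
  - by move=> t; rewrite mulrDr mulr1 addrA fz.
have mf2 : measurable_fun setT (fun z : R * R => f (z.1 + D%:~R * z.2)%R).
  apply: measurableT_comp => //; apply: measurable_funD => //.
  exact: measurable_funM.
transitivity (\int[U]_s \int[U]_t f (s + D%:~R * t)%R).
  under [RHS]eq_integral do rewrite -shift.
  by rewrite integral_unit_cst.
transitivity (\int[U]_t \int[U]_s f (s + D%:~R * t)%R).
  by have := @fubini_tonelli _ _ _ _ R unit_prob unit_prob _ mf2; exact.
under eq_integral do rewrite (@integral_unit_shift _ f) //.
by rewrite integral_unit_cst.
Qed.

(** The lift to the line of a ball of the circle; the integer [p] is one coordinate of the integer
    vector in the approximation condition. *)
Definition periodic_ball (c rho : R) : set R :=
  [set y | exists p : int, (`|y + p%:~R - c| < rho)%R].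

Lemma periodic_ballD1 c rho y :
  periodic_ball c rho (y + 1)%R <-> periodic_ball c rho y.
Proof.
split=> -[p yp].
  by exists (p + 1)%R; rewrite intrD (addrC _ 1%R) addrA.
by exists (p - 1)%R; rewrite intrB (addrC p%:~R) addrA addrK.
Qed.

Lemma measurable_periodic_ball c rho : measurable (periodic_ball c rho).
Proof.
rewrite (_ : periodic_ball c rho =
    \bigcup_(p : int) [set y | (`|y + p%:~R - c| < rho)%R]).
  apply: countable_bigcupT_measurable => [|p]; first exact: countableP.
  rewrite (_ : [set _ | _] = `]c - p%:~R - rho, c - p%:~R + rho[%classic)%R.
    exact: measurable_itv.
  by apply/seteqP; split => y /=; rewrite in_itv /= ltr_norml; lra.
by apply/seteqP; split => y /= [p]; [exists p|move=> _; exists p].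
Qed.

Definition pball_indic c rho (y : R) : R := \1_(periodic_ball c rho) y.

Lemma pball_indicD1 c rho y : pball_indic c rho (y + 1)%R = pball_indic c rho y.
Proof.
by apply: indic_congr; exact: periodic_ballD1.
Qed.

Lemma pball_indic_ge0 c rho y : (0 <= pball_indic c rho y)%R.
Proof. by rewrite /pball_indic indicE. Qed.

Lemma measurable_pball_indic c rho : measurable_fun setT (pball_indic c rho).
Proof. by apply: measurable_indic; exact: measurable_periodic_ball. Qed.

(** A shift moves the centre to 1/2. As [rho] is at most 1/2, only [p = 0] can then bring a point of
    [0, 1) into the ball, and an interval of length [2 * rho] remains. *)
Lemma integral_pball_indic c rho : (0 < rho <= 2^-1)%R ->
  \int[U]_y (pball_indic c rho y)%:E = (2 * rho)%:E.
Proof.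
move=> /andP[rho0 rho2].
have mE b : measurable_fun setT (fun y => (pball_indic b rho y)%:E).
  by apply/measurable_EFinP; exact: measurable_pball_indic.
have g0 b y : 0 <= (pball_indic b rho y)%:E by rewrite lee_fin pball_indic_ge0.
rewrite -(integral_unit_shift (c - 2^-1)%R) //; last first.
  by move=> y; rewrite pball_indicD1.
under eq_integral => y _.
  rewrite (_ : pball_indic c rho _ = pball_indic 2^-1 rho y); last first.
    by apply: indic_congr; split => -[p yp]; exists p;
      move: yp; have -> : (y + (c - 2^-1) + p%:~R - c = y + p%:~R - 2^-1)%R by ring.
  over.
rewrite integral_unit_prob //.
transitivity (\int[lebesgue_measure]_(y in `[0%R, 1%R[)
    (\1_(`]2^-1 - rho, 2^-1 + rho[%classic : set R)%R y)%:E).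
  apply: eq_integral.
  move=> y; rewrite inE /= in_itv /= => y01.
  congr EFin; apply: indic_congr; rewrite /= in_itv /=; split.
    move=> -[p]; rewrite ltr_norml => yp.
    have p1 : (p < 1)%R by rewrite -(ltr_int R); lra.
    have p0 : (-1 < p)%R by rewrite -(ltr_int R); lra.
    have p_eq0 : p = 0%R by lia.
    by move: yp; rewrite p_eq0; lra.
  by move=> yI; exists 0%R; rewrite ltr_norml; lra.
rewrite integral_indic // setIidl; last first.
  by move=> y /=; rewrite !in_itv /=; lra.
transitivity (@lebesgue_measure R `]2^-1 - rho, 2^-1 + rho[%classic)%R => //.
rewrite lebesgue_measure_itv /= lte_fin ifT; last by lra.
by rewrite -EFinB; congr (_%:E); ring.
Qed.
End UnitInterval.

(** * Overlaps of dilated periodic balls *)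

Lemma coprime_residue_inj (a b : nat) (k l : nat) (p r : int) :
  coprime a b -> (k < a)%N -> (l < a)%N ->
  (b%:Z * k%:Z + p * a%:Z = b%:Z * l%:Z + r * a%:Z)%R -> k = l.
Proof.
move=> cab ka la e.
have : (a%:Z %| b%:Z * (k%:Z - l%:Z))%Z.
  apply/dvdzP; exists (r - p)%R; rewrite mulrBr mulrBl.
  by move: e; lia.
rewrite Gauss_dvdzr // => /dvdzP[z kl].
have z0 : z = 0%R by nia.
by move: kl; rewrite z0; lia.
Qed.

Section Overlap.
Context {R : realType}.
Implicit Types (c rho : R) (a b d : nat).

(** Every [k] that is counted yields an integer b k + p a in the open interval from [x] to [x + L].
    Distinct [k] yield distinct integers because [b] is invertible modulo [a], and the interval
    contains at most floor(L) + 1 integers. *)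
Lemma sum_pball_indic_le a b c rho (u : R) : (0 < a)%N -> coprime a b -> 0 < rho ->
  \sum_(k < a) pball_indic c rho (u + (b * k)%:R / a%:R) <= a%:R * (2 * rho) + 1.
Proof.
move=> a0 cab rho0; pose L := a%:R * (2 * rho).
have aR : 0 < a%:R :> R by rewrite ltr0n.
have L0 : 0 <= L by rewrite mulr_ge0 // mulr_ge0 // ltW.
pose x := a%:R * (c - rho - u).
pose hit (k : 'I_a) (p : int) := `|u + (b * k)%:R / a%:R + p%:~R - c| < rho.
have hitP (k : 'I_a) p : hit k p -> exists i : nat,
    (i <= Num.truncn L)%N /\
    (b%:Z * k%:Z + p * a%:Z = i%:Z + (Num.floor x + 1))%R.
  rewrite /hit ltr_norml => /andP[h1 h2].
  pose n : int := b%:Z * k%:Z + p * a%:Z.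
  have nE : n%:~R = a%:R * ((b * k)%:R / a%:R + p%:~R) :> R.
    rewrite /n intrD !intrM mulrDr mulrCA divff ?gt_eqF // mulr1 natrM.
    by rewrite -!pmulrn (mulrC a%:R).
  have xn : x < n%:~R by rewrite nE /x ltr_pM2l //; lra.
  have nx : n%:~R < x + L.
    by rewrite nE /x /L -mulrDr ltr_pM2l //; lra.
  have fn : (Num.floor x < n)%R by rewrite -(ltr_int R) (le_lt_trans (floor_le _)).
  have n_ge : (0 <= n - (Num.floor x + 1))%R by lia.
  (* Integers above [x] are numbered from 0, the first one being [Num.floor x + 1]. *)
  exists `|(n - (Num.floor x + 1))%R|%N; rewrite -/n; split; last by lia.
  rewrite truncn_ge_nat // pmulrn gez0_abs // intrB intrD.
  have := floorD1_gt x; rewrite intrD; move: nx; lra.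
pose K := [pred k : 'I_a | u + (b * k)%:R / a%:R \in periodic_ball c rho].
have sumE : \sum_(k < a) pball_indic c rho (u + (b * k)%:R / a%:R) = #|K|%:R.
  rewrite -sum1_card natr_sum [RHS]big_mkcond /=; apply: eq_bigr => k _.
  by rewrite /pball_indic indicE unfold_in /=; case: ifP.
(* The index defaults to 0 when [k] is not counted, so that [choice] gives a total map. *)
have ex_hit (k : 'I_a) : exists i : nat, k \in K -> (i <= Num.truncn L)%N /\
    exists p, (b%:Z * k%:Z + p * a%:Z = i%:Z + (Num.floor x + 1))%R.
  have [kK|_] := boolP (k \in K); last by exists 0%N.
  move: kK; rewrite unfold_in /= inE => -[p /hitP[i [iL iE]]].
  by exists i => _; split => //; exists p.
have /choice[h hP] := ex_hit.
rewrite sumE (@le_trans _ _ (Num.truncn L).+1%:R) //; last first.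
  by rewrite -natr1 lerD2r truncn_le.
rewrite ler_nat.
rewrite -(@card_in_imset _ _ (fun k => inord (h k) : 'I_(Num.truncn L).+1)).
  by rewrite (leq_trans (max_card _)) // card_ord.
move=> k l kK lK /(congr1 val); have [hk [p pE]] := hP _ kK.
have [hl [r rE]] := hP _ lK.
rewrite /= !inordK ?ltnS // => hkl; apply: val_inj => /=.
apply: (@coprime_residue_inj a b k l p r) => //.
by rewrite pE rE hkl.
Qed.

Local Open Scope ereal_scope.

Lemma integral_unit_pball_dilate (q : nat) c rho : (0 < q)%N ->
  (0 < rho <= 2^-1)%R ->
  \int[unit_prob]_t (pball_indic c rho (q%:R * t))%:E = (2 * rho)%:E.
Proof.
move=> q0 rho0; rewrite -(integral_pball_indic c) //.
rewrite -(@integral_unit_dilate _ q%:Z 0%R (fun t => (pball_indic c rho t)%:E)) //.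
- by apply: eq_integral => t _; rewrite add0r -pmulrn.
- by lia.
- by apply/measurable_EFinP; exact: measurable_pball_indic.
- by move=> x; rewrite lee_fin pball_indic_ge0.
- by move=> x; rewrite pball_indicD1.
Qed.

(* Averaging over the translations t -> t + k/q, under which the first factor
   is invariant, turns the second factor into a counting problem. *)
Lemma integral_pball_overlap a b d c rho c' rho' :
  (0 < a)%N -> (0 < d)%N -> coprime a b ->
  (0 < rho <= 2^-1)%R -> (0 < rho')%R ->
  \int[unit_prob]_t (pball_indic c rho ((a * d)%:R * t) *
                     pball_indic c' rho' ((b * d)%:R * t))%:E
  <= (2 * rho * (2 * rho' + a%:R^-1))%:E.
Proof.
move=> a0 d0 cab rho0 rho'0.
pose f t := pball_indic c rho ((a * d)%:R * t).
pose g t := pball_indic c' rho' ((b * d)%:R * t).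
have aR : (0 < a%:R :> R)%R by rewrite ltr0n.
have dR : (0 < d%:R :> R)%R by rewrite ltr0n.
have adR : (0 < (a * d)%:R :> R)%R by rewrite ltr0n muln_gt0 a0.
have f0 t : (0 <= f t)%R by exact: pball_indic_ge0.
have g0 t : (0 <= g t)%R by exact: pball_indic_ge0.
have mf : measurable_fun setT f.
  by apply: measurableT_comp => //; exact: measurable_pball_indic.
have mg : measurable_fun setT g.
  by apply: measurableT_comp => //; exact: measurable_pball_indic.
have mfg : measurable_fun setT (fun t => (f t * g t)%:E).
  by apply/measurable_EFinP; exact: measurable_funM.
(* Since [f] has period 1/(ad), a translation by k/(ad) changes only [g]. *)
have shift (k : nat) : \int[unit_prob]_t (f t * g t)%:E =
    \int[unit_prob]_t (f t * g (t + k%:R / (a * d)%:R))%:E.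
  rewrite -(@integral_unit_shift _ (k%:R / (a * d)%:R)) //.
  - apply: eq_integral => t _; congr (_ * _)%:E; rewrite /f mulrDr.
    rewrite mulrCA divff ?gt_eqF // mulr1.
    by rewrite (pmulrn _ k) periodic_int // => x; rewrite pball_indicD1.
  - by move=> x; rewrite lee_fin mulr_ge0.
  - move=> x; rewrite /f /g !mulrDr !mulr1 !pmulrn.
    by rewrite !periodic_int // => y; rewrite pball_indicD1.
have mgs k : measurable_fun setT (fun t => (f t * g (t + k%:R / (a * d)%:R))%:E).
  apply/measurable_EFinP; apply: measurable_funM => //.
  by apply: measurableT_comp => //; exact: measurable_funD.
(* The translation moves the argument of the second ball by b k/a, so the sum over [k < a] is
   bounded pointwise by [sum_pball_indic_le]. *)
have sum_le : a%:R%:E * \int[unit_prob]_t (f t * g t)%:E <=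
    (2 * rho * (a%:R * (2 * rho') + 1))%:E.
  have -> : a%:R%:E * \int[unit_prob]_t (f t * g t)%:E =
      \sum_(k < a) \int[unit_prob]_t (f t * g (t + k%:R / (a * d)%:R))%:E.
    under eq_bigr do rewrite -shift.
    by rewrite sumr_const card_ord mule_natl.
  rewrite -ge0_integral_sum //; last first.
  - by move=> k t _; rewrite lee_fin mulr_ge0.
  - by move=> k; exact: mgs.
  apply: (@le_trans _ _ (\int[unit_prob]_t ((f t)%:E * (a%:R * (2 * rho') + 1)%:E))).
    apply: ge0_le_integral => //.
    - by move=> t _; apply: sume_ge0 => k _; rewrite lee_fin mulr_ge0.
    - by apply: emeasurable_sum => k; exact: mgs.
    - by apply: emeasurable_funM => //; exact/measurable_EFinP.
    - move=> t _; rewrite sumEFin lee_fin -mulr_sumr ler_wpM2l //.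
      rewrite /g; under eq_bigr => k _.
        rewrite mulrDr (_ : (_ * (_ / _) = (b * k)%:R / a%:R)%R); last first.
          by rewrite !natrM; field; rewrite !gt_eqF.
        over.
      exact: sum_pball_indic_le.
  rewrite ge0_integralZr //; last 3 first.
  - exact/measurable_EFinP.
  - by move=> t _; rewrite lee_fin.
  - by rewrite lee_fin addr_ge0 // !mulr_ge0 // ltW.
  by rewrite integral_unit_pball_dilate ?muln_gt0 ?a0.
have ainv : (2 * rho * (2 * rho' + a%:R^-1) = a%:R^-1 * (2 * rho * (a%:R * (2 * rho') + 1)))%R.
  by field; rewrite gt_eqF.
rewrite ainv EFinM -[leLHS]mul1e.
rewrite (_ : 1 = (a%:R^-1)%:E * a%:R%:E)%E; last first.
  by rewrite -EFinM mulVf // gt_eqF.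
by rewrite -muleA lee_wpmul2l // lee_fin invr_ge0 ltW.
Qed.

End Overlap.

(** * Borel-Cantelli from second moments *)

(** A set of indices is infinite exactly when its codes under [pickle] are unbounded, which writes
    the set as a countable intersection of countable unions. *)
Lemma measurable_limsup d (T : measurableType d) (I : countType) (A : I -> set T) :
  (forall i, measurable (A i)) ->
  measurable [set z | infinite_set [set i | A i z]].
Proof.
move=> mA.
rewrite (_ : [set z | _] =
    \bigcap_(n : nat) \bigcup_i (if (n <= pickle i)%N then A i else set0)).
  apply: bigcapT_measurable => n; apply: countable_bigcupT_measurable => [|i].
    exact: countableP.
  by case: ifP.
apply/seteqP; split => z /=.
  move=> infA n _; apply: contrapT => noA; apply: infA.
  apply: (@sub_finite_set _ _ (pickle @^-1` `I_n)).
    move=> i Ai /=; rewrite ltnNge; apply/negP => ni; apply: noA.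
    by exists i => //; rewrite ni.
  apply: finite_preimage; last exact: finite_II.
  by move=> i j _ _; exact: (pcan_inj pickleK).
move=> capA /finite_seqP[s sE].
have [i _] := capA (\max_(j <- s) (pickle j)).+1 Logic.I; case: ifP => // si Ai.
have : i \in s by have : [set i | A i z] i by []; rewrite sE.
by move=> /(fun h => @leq_bigmax_seq _ s xpredT pickle i h isT); rewrite leqNgt si.
Qed.

Section SecondMoment.
Context d (T : measurableType d) (R : realType) (P : probability T R).
Context (I : countType) (A : I -> set T) (w : I -> R).
Hypothesis mA : forall i, measurable (A i).
Hypothesis w0 : forall i, 0 <= w i.

(** [S] is the weighted counting function over the list [s], [M] its mean and [Q] its second
    moment. *)
Let S (s : seq I) (z : T) : R := \sum_(i <- s) w i * \1_(A i) z.
Let M (s : seq I) : R := \sum_(i <- s) w i * fine (P (A i)).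
Let Q (s : seq I) : R :=
  \sum_(i <- s) \sum_(j <- s) w i * w j * fine (P (A i `&` A j)).

Let S_ge0 s z : 0 <= S s z.
Proof. by apply: sumr_ge0 => i _; rewrite mulr_ge0 // indicE. Qed.

Let mS s : measurable_fun setT (S s).
Proof.
by apply: measurable_sum => i; apply: measurable_funM => //; exact: measurable_indic.
Qed.

Let M_ge0 s : 0 <= M s.
Proof. by apply: sumr_ge0 => i _; rewrite mulr_ge0 // fine_ge0. Qed.

Local Open Scope ereal_scope.

Let measurable_windic (k : R) (B : set T) : measurable B ->
  measurable_fun setT (fun z => (k * \1_B z)%:E).
Proof.
move=> mB; apply/measurable_EFinP; apply: measurable_funM.
  exact: measurable_cst.
exact: measurable_indic.
Qed.

Let integral_windic (k : R) (B : set T) : (0 <= k)%R -> measurable B ->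
  \int[P]_z (k * \1_B z)%:E = (k * fine (P B))%:E.
Proof.
move=> k0 mB; under eq_integral do rewrite EFinM.
rewrite ge0_integralZl //; last first.
  by apply/measurable_EFinP; exact: measurable_indic.
by rewrite integral_indic // setIT EFinM fineK // fin_num_measure.
Qed.

Let integral_S s : \int[P]_z (S s z)%:E = (M s)%:E.
Proof.
under eq_integral do rewrite -sumEFin.
rewrite ge0_integral_sum //; last 2 first.
- by move=> i; exact: measurable_windic.
- by move=> i z _; rewrite lee_fin mulr_ge0 // indicE.
by rewrite -sumEFin; apply: eq_bigr => i _; exact: integral_windic.
Qed.

Let integral_S2 s : \int[P]_z (S s z ^+ 2)%:E = (Q s)%:E.
Proof.
have SE z : (S s z ^+ 2)%:E =
    \sum_(i <- s) \sum_(j <- s) (w i * w j * \1_(A i `&` A j) z)%:E.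
  rewrite expr2 {1}/S mulr_suml -sumEFin; apply: eq_bigr => i _.
  rewrite sumEFin mulr_sumr; congr EFin; apply: eq_bigr => j _.
  by rewrite indicI /=; ring.
under eq_integral do rewrite SE.
have m2 i j : measurable_fun setT (fun z => (w i * w j * \1_(A i `&` A j) z)%:E).
  by apply: measurable_windic; exact: measurableI.
have ge2 i j z : 0 <= (w i * w j * \1_(A i `&` A j) z)%:E.
  by rewrite lee_fin mulr_ge0 ?mulr_ge0 // indicE.
rewrite ge0_integral_sum //; last 2 first.
- by move=> i; apply: emeasurable_sum => j; exact: m2.
- by move=> i z _; apply: sume_ge0.
rewrite -sumEFin; apply: eq_bigr => i _.
rewrite ge0_integral_sum //.
rewrite -sumEFin; apply: eq_bigr => j _; apply: integral_windic.
  exact: mulr_ge0.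
exact: measurableI.
Qed.

(* [(S - M)^2 + 2 M S = S^2 + M^2] keeps every integrand nonnegative. *)
Let variance s : \int[P]_z ((S s z - M s) ^+ 2)%:E = (Q s - M s ^+ 2)%:E.
Proof.
have mV : measurable_fun setT (fun z => ((S s z - M s) ^+ 2)%:E).
  apply/measurable_EFinP; apply: measurable_funX.
  exact: measurable_funB.
have cstP (k : R) : \int[P]_z k%:E = k%:E.
  rewrite integral_cst //; transitivity (k%:E * 1); last by rewrite mule1.
  by congr (_ * _); exact: probability_setT.
have mES : measurable_fun setT (fun z => (S s z)%:E) by exact/measurable_EFinP.
have e : \int[P]_z ((S s z - M s) ^+ 2)%:E + (2 * M s * M s)%:E =
    (Q s + M s ^+ 2)%:E.
  rewrite [in LHS]EFinM -integral_S -ge0_integralZl //; last 2 first.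
  - by move=> z _; rewrite lee_fin.
  - by rewrite lee_fin mulr_ge0.
  rewrite -ge0_integralD //; last 3 first.
  - by move=> z _; rewrite lee_fin sqr_ge0.
  - by move=> z _; rewrite -EFinM lee_fin !mulr_ge0.
  - exact: measurable_funeM.
  rewrite EFinD -integral_S2 -[in RHS]cstP -ge0_integralD //.
  - by apply: eq_integral => z _; rewrite -EFinM -!EFinD; congr EFin; ring.
  - by move=> z _; rewrite lee_fin sqr_ge0.
  - by apply/measurable_EFinP; exact: measurable_funX.
  - by move=> z _; rewrite lee_fin sqr_ge0.
have -> : (Q s - M s ^+ 2)%:E = (Q s + M s ^+ 2)%:E - (2 * M s * M s)%:E.
  by rewrite -EFinB; congr EFin; ring.
by rewrite -e addeK.
Qed.

Let measurable_le s (K : R) : measurable [set z | S s z <= K]%R.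
Proof.
rewrite (_ : [set z | _] = setT `&` S s @^-1` `]-oo, K]%classic).
  exact: mS.
by apply/seteqP; split => z /=; rewrite in_itv //= => -[].
Qed.

(** Where [S s z <= K], the deviation from the mean is at least [M s - K], hence at least half of
    [M s]; its square is then integrated over this set and compared with the variance. *)
Let chebyshev_half s (K : R) : (2 * K <= M s)%R ->
  (fine (P [set z | S s z <= K]%R) * (M s ^+ 2 / 4) <= Q s - M s ^+ 2)%R.
Proof.
move=> KM.
have mB := measurable_le s K.
rewrite -lee_fin -variance mulrC -integral_windic //; last first.
  by rewrite divr_ge0 // sqr_ge0.
apply: ge0_le_integral => //.
- by move=> z _; rewrite lee_fin mulr_ge0 ?divr_ge0 ?sqr_ge0 // indicE.
- exact: measurable_windic.
- apply/measurable_EFinP; apply: measurable_funX.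
  exact: measurable_funB.
move=> z _; rewrite lee_fin indicE.
case: (boolP (z \in _)) => [|_]; last by rewrite mulr0 sqr_ge0.
rewrite mulr1.
rewrite inE /= => SK.
have := M_ge0 s; nra.
Qed.

Let bounded_null (s : nat -> seq I) (K : R) :
  (forall L : R, exists N, L <= M (s N))%R ->
  (forall eta : R, (0 < eta)%R -> exists C : R,
     forall N, Q (s N) <= (1 + eta) * M (s N) ^+ 2 + C * M (s N))%R ->
  P (\bigcap_N [set z | S (s N) z <= K]%R) = 0.
Proof.
move=> unbM secM; set B := \bigcap_N _.
have mB : measurable B by apply: bigcapT_measurable => N; exact: measurable_le.
apply/eqP; rewrite eq_le measure_ge0 andbT leNgt; apply/negP => PB0.
have PBfin : P B \is a fin_num by exact: fin_num_measure.
have b0 : (0 < fine (P B))%R by rewrite fine_gt0 // PB0 ltey_eq PBfin.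
set b := fine (P B) in b0.
(* With eta = b/8, Chebyshev's bound b M^2/4 <= eta M^2 + C M becomes b M <= 8 C, which fails for
   large M. *)
have [C secC] := secM (b / 8)%R (divr_gt0 b0 (ltr0Sn _ 7)).
(* Absolute values are used since neither [K] nor [C] has a known sign. *)
have [N MN] := unbM (`|2 * K| + `|8 * C / b| + 1)%R.
have KM : (2 * K <= M (s N))%R.
  by have := ler_norm (2 * K)%R; have := normr_ge0 (8 * C / b)%R; lra.
have CM : (8 * C / b < M (s N))%R.
  by have := ler_norm (8 * C / b)%R; have := normr_ge0 (2 * K)%R; lra.
have M1 : (0 < M (s N))%R.
  by have := normr_ge0 (8 * C / b)%R; have := normr_ge0 (2 * K)%R; lra.
have bN : (b <= fine (P [set z | S (s N) z <= K]%R))%R.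
  have mBN := measurable_le (s N) K.
  apply: fine_le; rewrite ?fin_num_measure //.
  apply: le_measure; rewrite ?inE // => z Bz.
  exact: (Bz N).
have := chebyshev_half _ _ KM; have := secC N.
move: CM; rewrite ltr_pdivrMr // => CM h1 h2.
have M2 : (0 <= M (s N) ^+ 2 / 4)%R by rewrite divr_ge0 // sqr_ge0.
have h3 := ler_wpM2r M2 bN.
have h4 : (b * M (s N) ^+ 2 / 8 <= C * M (s N))%R by lra.
have : (b * M (s N) <= 8 * C)%R by rewrite -(ler_pM2r M1); lra.
by rewrite leNgt (mulrC b) CM.
Qed.

(** At a point lying in only finitely many events, the counting functions of all lists [s N] are
    bounded by the number of these events, because weights are at most 1 and the lists have no
    repetitions. Such points lie in a countable union, over integer bounds, of the null sets of
    [bounded_null]. *)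
Lemma infinitely_often_as (s : nat -> seq I) :
  (forall i, w i <= 1)%R -> (forall N, uniq (s N)) ->
  (forall L : R, exists N, L <= M (s N))%R ->
  (forall eta : R, (0 < eta)%R -> exists C : R,
     forall N, Q (s N) <= (1 + eta) * M (s N) ^+ 2 + C * M (s N))%R ->
  P [set z | infinite_set [set i | A i z]] = 1.
Proof.
move=> w1 us unbM secM.
have mL := @measurable_limsup _ _ _ _ mA.
suff PC0 : P (~` [set z | infinite_set [set i | A i z]]) = 0.
  by rewrite -(setCK [set z | _]) probability_setC ?PC0 ?sube0 //; exact: measurableC.
have mB K : measurable (\bigcap_N [set z | S (s N) z <= K%:R]%R).
  by apply: bigcapT_measurable => N; exact: measurable_le.
apply/negligibleP; first exact: measurableC.
apply: (@negligibleS _ _ _ _ (\bigcup_K \bigcap_N [set z | S (s N) z <= K%:R]%R)).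
  move=> z /contrapT /finite_seqP[F FE]; exists (size F) => // N _ /=.
  apply: (@le_trans _ _ (\sum_(i <- s N | i \in F) 1)%R).
    rewrite [leRHS]big_mkcond /=; apply: ler_sum => i _.
    rewrite indicE (_ : (z \in A i) = (i \in F)).
      by case: (i \in F); rewrite ?mulr1 ?mulr0.
    have AF : A i z <-> i \in F by have := congr1 (@^~ i) FE => /= ->.
    by apply/idP/idP => [|iF]; [rewrite inE => /AF|rewrite inE; apply/AF].
  rewrite -big_filter big_const_seq iter_addr_0 count_predT ler_nat.
  apply: uniq_leq_size; first by rewrite filter_uniq.
  by move=> i; rewrite mem_filter => /andP[].
apply: negligible_bigcup => K; apply/negligibleP => //.
exact: bounded_null.
Qed.

End SecondMoment.

(** * Linear forms on the unit square *)

Section Square.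
Context {R : realType}.
Local Notation mu := (@lebesgue_measure R).
Local Notation U := (@unit_prob R).
Local Open Scope ereal_scope.

Lemma unit_prob_lebesgue (A : set R) : measurable A -> A `<=` `[0%R, 1%R] ->
  U A = mu A.
Proof.
move=> mA A01; rewrite /unit_prob /uniform_prob.
rewrite (eq_integral (fun=> 1)); last first.
  move=> x; rewrite inE => /A01 /=; rewrite in_itv /= /uniform_pdf => ->.
  by rewrite subr0 invr1.
by rewrite integral_cst // mul1e.
Qed.

(** Both measures integrate the measure of the sections at fixed x: these agree inside the unit
    interval and are empty outside it. *)
Lemma lebesgue2_unit_square (Z : set (R * R)) : measurable Z ->
  (forall z, Z z -> (0 <= z.1 <= 1)%R /\ (0 <= z.2 <= 1)%R) ->
  lebesgue2 Z = (U \x U) Z.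
Proof.
move=> mZ Z01; rewrite /lebesgue2 /product_measure1.
have secE x : (mu \o xsection Z) x = (U \o xsection Z) x.
  rewrite /= unit_prob_lebesgue //; first exact: measurable_xsection.
  by move=> y; rewrite /xsection /= inE => /Z01[_] /=; rewrite in_itv.
rewrite integral_uniform //=; last exact: measurable_fun_xsection.
rewrite subr0 invr1 mul1e [RHS]integral_mkcond; apply: eq_integral => x _.
rewrite patchE; case: ifPn => [_|x01] /=; first exact: secE.
rewrite (_ : xsection Z x = set0) ?measure0 //.
apply/seteqP; split => // y; rewrite /xsection /= inE => /Z01[/= x1 _].
by move: x01; rewrite notin_setE /= in_itv /= x1.
Qed.

Lemma integral_unit2_shift (s t : R) (F : R * R -> \bar R) :
  measurable_fun setT F -> (forall z, 0 <= F z) ->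
  (forall x y, F (x + 1, y)%R = F (x, y)) -> (forall x y, F (x, y + 1)%R = F (x, y)) ->
  \int[U \x U]_z F (z.1 + s, z.2 + t)%R = \int[U \x U]_z F z.
Proof.
move=> mF F0 Fx Fy.
have mFs : measurable_fun setT (fun z : R * R => F (z.1 + s, z.2 + t)%R).
  apply: measurableT_comp => //; apply: measurable_fun_pair => /=.
  - by apply: measurable_funD.
  - by apply: measurable_funD.
rewrite !fubini_tonelli1 // /fubini_F /=.
transitivity (\int[U]_x \int[U]_y F (x + s, y)%R).
  apply: eq_integral => x _.
  rewrite (@integral_unit_shift _ t (fun y => F (x + s, y)%R)) //.
  exact: measurableT_comp.
rewrite (@integral_unit_shift _ s (fun x => \int[U]_y F (x, y))) //.
- by have := @measurable_fun_fubini_tonelli_F _ _ _ _ R U F mF F0; exact.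
- by move=> x; exact: integral_ge0.
- by move=> x; apply: eq_integral => y _; exact: Fx.
Qed.

Lemma measurable_linear (a b : R) :
  measurable_fun setT (fun z : R * R => a * z.1 + b * z.2)%R.
Proof.
by apply: measurable_funD; apply: measurable_funM.
Qed.

(** For a fixed first coordinate, the form is a translated dilation by [Q] in the second one. *)
Lemma integral_linear (k Q : nat) c rho : (0 < Q)%N -> (0 < rho <= 2^-1)%R ->
  \int[U \x U]_z (pball_indic c rho (k%:R * z.1 + Q%:R * z.2))%:E = (2 * rho)%:E.
Proof.
move=> Q0 rho0; pose g (z : R * R) := (pball_indic c rho (k%:R * z.1 + Q%:R * z.2))%:E.
have mg : measurable_fun setT g.
  apply/measurable_EFinP.
  by apply: measurableT_comp; [exact: measurable_pball_indic|exact: measurable_linear].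
have g0 z : 0 <= g z by rewrite lee_fin pball_indic_ge0.
transitivity (\int[U]_x \int[U]_y g (x, y)).
  by have := @fubini_tonelli1 _ _ _ _ R U U g mg g0; exact.
rewrite -[RHS]integral_unit_cst; apply: eq_integral => x _.
rewrite -(integral_pball_indic c rho) //.
rewrite -(@integral_unit_dilate _ Q%:Z (k%:R * x)%R
  (fun y => (pball_indic c rho y)%:E)) //; first by lia.
- by apply/measurable_EFinP; exact: measurable_pball_indic.
- by move=> y; rewrite lee_fin pball_indic_ge0.
- by move=> y; rewrite pball_indicD1.
Qed.

(* Translating by [t (Q', -k')] leaves the second linear form unchanged and
   moves the first one by [t D]; averaging over [t] decouples them. *)
Lemma integral_linear_indep (k Q k' Q' : nat) c rho c' rho' :
  (k * Q' != k' * Q)%N -> (0 < Q')%N ->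
  (0 < rho <= 2^-1)%R -> (0 < rho' <= 2^-1)%R ->
  \int[U \x U]_z (pball_indic c rho (k%:R * z.1 + Q%:R * z.2) *
                  pball_indic c' rho' (k'%:R * z.1 + Q'%:R * z.2))%:E
  = (2 * rho * (2 * rho'))%:E.
Proof.
move=> D0 Q0 rho0 rho'0.
(* The determinant of the two forms. *)
pose D : int := ((k * Q')%:Z - (k' * Q)%:Z)%R.
have Dne0 : D != 0%R by rewrite /D; lia.
pose u (z : R * R) := (k%:R * z.1 + Q%:R * z.2)%R.
pose f y := pball_indic c rho y.
pose g (z : R * R) := pball_indic c' rho' (k'%:R * z.1 + Q'%:R * z.2).
have f0 y : (0 <= f y)%R by exact: pball_indic_ge0.
have g0 z : (0 <= g z)%R by exact: pball_indic_ge0.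
have mf : measurable_fun setT f by exact: measurable_pball_indic.
have mu_ : measurable_fun setT u by exact: measurable_linear.
have mg : measurable_fun setT g.
  by apply: measurableT_comp; [exact: measurable_pball_indic|exact: measurable_linear].
have per c1 rho1 (x : R) (p : nat) :
    pball_indic c1 rho1 (x + p%:R)%R = pball_indic c1 rho1 x.
  by rewrite (pmulrn _ p) periodic_int // => y; exact: pball_indicD1.
have mfg (t : R) : measurable_fun setT (fun z => (f (u z + D%:~R * t) * g z)%:E).
  apply/measurable_EFinP; apply: measurable_funM => //.
  by apply: measurableT_comp => //; exact: measurable_funD.
have shift (t : R) : \int[U \x U]_z (f (u z) * g z)%:E =
    \int[U \x U]_z (f (u z + D%:~R * t) * g z)%:E.
  rewrite -(@integral_unit2_shift (t * Q'%:R) (- (t * k'%:R))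
    (fun z => (f (u z) * g z)%:E)).
  - apply: eq_integral => z _; congr (_ * _)%:E.
      congr f; rewrite /u /= /D intrB -!pmulrn !natrM; ring.
    by rewrite /g /=; congr pball_indic; ring.
  - by apply/measurable_EFinP; apply: measurable_funM => //; exact: measurableT_comp.
  - by move=> z; rewrite lee_fin mulr_ge0.
  - move=> x y; congr (_ * _)%:E; rewrite /f /u /g /=.
      by rewrite mulrDr mulr1 addrAC per.
    by rewrite mulrDr mulr1 addrAC per.
  - move=> x y; congr (_ * _)%:E; rewrite /f /u /g /=.
      by rewrite mulrDr mulr1 addrA per.
    by rewrite mulrDr mulr1 addrA per.
have mF : measurable_fun setT
    (fun w : R * (R * R) => (f (u w.2 + D%:~R * w.1) * g w.2)%:E).
  apply/measurable_EFinP; apply: measurable_funM.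
    apply: measurableT_comp => //; apply: measurable_funD.
      exact: measurableT_comp.
    exact: measurable_funM.
  exact: measurableT_comp.
transitivity (\int[U]_t \int[U \x U]_z (f (u z + D%:~R * t) * g z)%:E).
  under [RHS]eq_integral do rewrite -shift.
  by rewrite integral_unit_cst.
have F0 (w : R * (R * R)) : 0 <= (f (u w.2 + D%:~R * w.1) * g w.2)%:E.
  by rewrite lee_fin mulr_ge0.
transitivity (\int[U \x U]_z \int[U]_t (f (u z + D%:~R * t) * g z)%:E).
  pose P2 : probability _ R := (U \x U)%E.
  by have := @fubini_tonelli _ _ _ _ R U P2 _ mF F0; exact.
(* For fixed [z], the first form is a dilation by [D] in [t], so its factor averages to [2 * rho]
   independently of [z]. *)
have inner z : \int[U]_t (f (u z + D%:~R * t) * g z)%:E = (g z)%:E * (2 * rho)%:E.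
  under eq_integral do rewrite mulrC EFinM.
  rewrite ge0_integralZl //.
  - congr (_ * _); rewrite -(integral_pball_indic c rho) //.
    rewrite (@integral_unit_dilate _ D (u z) (fun y => (f y)%:E)) //.
    + exact/measurable_EFinP.
    + by move=> y; rewrite /f pball_indicD1.
  - apply/measurable_EFinP; apply: measurableT_comp => //.
    exact: measurable_funD.
  - by move=> t _; rewrite lee_fin.
  - by rewrite lee_fin.
under eq_integral do rewrite inner.
rewrite ge0_integralZr //; last 3 first.
- exact/measurable_EFinP.
- by move=> z _; rewrite lee_fin.
- by rewrite lee_fin mulr_ge0 // ltW //; case/andP: rho0.
rewrite [RHS]EFinM muleC; congr (_ * _).
exact: integral_linear.
Qed.

End Square.

(** * Divergent series and truncated radii *)

Lemma nneseries_unbounded (R : realType) (a b : nat -> R) :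
  (forall q, 0 <= a q) -> (forall q, a q <= b q) ->
  (\sum_(1 <= q <oo) (a q)%:E = +oo)%E ->
  forall L, exists N, L <= \sum_(1 <= q < N) b q.
Proof.
move=> a0 ab suma L; apply: contrapT => noN.
(* If every partial sum of [b] were below [L], comparison would bound the divergent series by
   [L]. *)
have : (\sum_(1 <= q <oo) (a q)%:E <= L%:E)%E.
  apply: lime_le.
    by apply: is_cvg_nneseries => q _ _; rewrite lee_fin.
  apply: nearW => N; rewrite sumEFin lee_fin.
  apply: (@le_trans _ _ (\sum_(1 <= q < N) b q)); first exact: ler_sum.
  by rewrite leNgt; apply/negP => /ltW LN; apply: noN; exists N.
by rewrite suma leye_eq.
Qed.

Lemma measure_integral_indic d (T : measurableType d) (R : realType)
    (m : {measure set T -> \bar R}) (A : set T) : measurable A ->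
  m A = (\int[m]_z (\1_A z)%:E)%E.
Proof. by move=> mA; rewrite integral_indic // setIT. Qed.

Section Radius.
Context {R : realType} (r : nat -> R).
Hypothesis r0 : forall q, 0 < r q.

(** The side of the torus ball, whose m-th power is [torus_ball_vol]. Half of it is a radius at most
    1/2, for which measures are exact, and at most [r q], so solutions for the shrunken ball solve
    the original problem. *)
Definition diam (q : nat) : R := Num.min (2 * r q) 1.

Lemma diam_gt0 q : 0 < diam q.
Proof. by rewrite /diam lt_min ltr01 andbT mulr_gt0. Qed.

Lemma half_diam_itv q : 0 < diam q / 2 <= 2^-1.
Proof.
have := diam_gt0 q; have : diam q <= 1 by rewrite /diam ge_min lexx orbT.
lra.
Qed.

Lemma half_diam_le q : diam q / 2 <= r q.
Proof.
have : diam q <= 2 * r q by rewrite /diam ge_min lexx.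
lra.
Qed.

End Radius.

(** * Primitive linear forms, for (n, m) = (2, 1) *)

Section LinearForms.
Context {R : realType} (c : nat -> R) (r : nat -> R).
Hypothesis r0 : forall q, 0 < r q.
Local Notation U := (@unit_prob R).
Local Notation delta := (diam r).

(** The pair [(Q, k)] encodes the vector (k, Q), with its sup norm [Q] placed first. *)
Definition primitive_pair (i : nat * nat) : bool :=
  [&& (0 < i.1)%N, (i.2 < i.1)%N & coprime i.1 i.2].

(** If k Q' = k' Q, coprimality makes [Q] and [Q'] divide each other; they are then equal, and so
    are [k] and [k']. *)
Lemma primitive_pair_det i j : primitive_pair i -> primitive_pair j -> i != j ->
  (i.2 * j.1 != j.2 * i.1)%N.
Proof.
case: i j => [Q k] [Q' k'] /and3P[/= Q0 _ cQk] /and3P[/= Q'0 _ cQk'].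
apply: contra => /eqP e.
have QQ' : (Q %| Q')%N by rewrite -(Gauss_dvdr _ cQk) e dvdn_mull.
have Q'Q : (Q' %| Q)%N by rewrite -(Gauss_dvdr _ cQk') -e dvdn_mull.
have eQ : Q = Q' by apply/eqP; rewrite eqn_dvd QQ'.
by move: e; rewrite eQ => /eqP; rewrite eqn_pmul2r // => /eqP ->.
Qed.

(** Empty at pairs that are not primitive, so that all of [nat * nat] can index the events. *)
Definition form_event (i : nat * nat) : set (R * R) :=
  [set z | primitive_pair i /\
    periodic_ball (c i.1) (delta i.1 / 2) (i.2%:R * z.1 + i.1%:R * z.2)].

Lemma form_event_indic i : primitive_pair i -> forall z,
  \1_(form_event i) z =
  pball_indic (c i.1) (delta i.1 / 2) (i.2%:R * z.1 + i.1%:R * z.2) :> R.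
Proof. by move=> pi z; apply: indic_congr; split=> [[]|]. Qed.

Lemma measurable_form_event i : measurable (form_event i).
Proof.
have [pi|npi] := boolP (primitive_pair i); last first.
  rewrite (_ : form_event i = set0) //.
  by apply/seteqP; split => // z [pi]; rewrite pi in npi.
rewrite (_ : form_event i = setT `&`
    (fun z : R * R => i.2%:R * z.1 + i.1%:R * z.2) @^-1`
    periodic_ball (c i.1) (delta i.1 / 2)).
  apply: measurable_linear => //; exact: measurable_periodic_ball.
by apply/seteqP; split => z /= [].
Qed.

Lemma form_event_prob i : primitive_pair i ->
  (U \x U)%E (form_event i) = (delta i.1)%:E.
Proof.
move=> pi; have mi := measurable_form_event i.
rewrite (@measure_integral_indic _ _ _ (U \x U)%E _ mi).
under eq_integral do rewrite form_event_indic //.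
case/and3P: (pi) => i0 _ _.
by rewrite integral_linear // ?half_diam_itv // mulrC divfK.
Qed.

Lemma form_event_indep i j : primitive_pair i -> primitive_pair j -> i != j ->
  (U \x U)%E (form_event i `&` form_event j) = (delta i.1 * delta j.1)%:E.
Proof.
move=> pi pj ij.
have mij := measurableI _ _ (measurable_form_event i) (measurable_form_event j).
rewrite (@measure_integral_indic _ _ _ (U \x U)%E _ mij).
under eq_integral do rewrite indicI /= !form_event_indic //.
case/and3P: (pj) => j0 _ _.
rewrite integral_linear_indep ?half_diam_itv //; last exact: primitive_pair_det.
by congr EFin; rewrite !(mulrC 2) !divfK.
Qed.

Definition primitive_pairs (N : nat) : seq (nat * nat) :=
  [seq (Q, k) | Q <- index_iota 1 N, k <- [seq k <- iota 0 Q | coprime Q k]].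

Lemma primitive_pairsP N i : i \in primitive_pairs N -> primitive_pair i.
Proof.
case/allpairsPdep => Q [k [+ + ->]]; rewrite mem_index_iota mem_filter mem_iota.
by move=> /andP[Q0 _] /and3P[cQk _ kQ]; apply/and3P.
Qed.

Lemma primitive_pairs_uniq N : uniq (primitive_pairs N).
Proof.
apply: allpairs_uniq_dep; first exact: iota_uniq.
  by move=> Q _; rewrite filter_uniq // iota_uniq.
by move=> [Q k] [Q' k'] _ _ [-> ->].
Qed.

Lemma sum_primitive_pairs N (F : nat -> R) :
  \sum_(i <- primitive_pairs N) F i.1 = \sum_(1 <= Q < N) (totient Q)%:R * F Q.
Proof.
rewrite big_allpairs_dep /=; apply: eq_bigr => Q _.
rewrite big_filter big_const_seq iter_addr_0 -[LHS]mulr_natl; congr (_%:R * _).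
by rewrite totient_count_coprime -sum1_count /index_iota subn0 [LHS]big_mkcond.
Qed.

(** By pairwise independence the second moment is at most M^2 + M, where the extra M accounts for
    the diagonal. *)
Lemma forms_infinitely_often :
  (forall L, exists N, L <= \sum_(1 <= q < N) (totient q)%:R * delta q) ->
  (U \x U)%E [set z | infinite_set [set i | form_event i z]] = 1%E.
Proof.
move=> unb.
have sumP N : \sum_(i <- primitive_pairs N) 1 * fine ((U \x U)%E (form_event i)) =
    \sum_(1 <= q < N) (totient q)%:R * delta q.
  rewrite -sum_primitive_pairs big_seq [RHS]big_seq; apply: eq_bigr => i iN.
  by rewrite mul1r form_event_prob //; exact: primitive_pairsP iN.
apply: (@infinitely_often_as _ _ R (U \x U)%E _ form_event (fun=> 1) _ _ primitive_pairs) => //.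
- exact: measurable_form_event.
- exact: primitive_pairs_uniq.
- by move=> L; have [N LN] := unb L; exists N; rewrite sumP.
move=> eta eta0; exists 1 => N; rewrite sumP.
set M := \sum_(1 <= q < N) _.
have M_E : M = \sum_(i <- primitive_pairs N) delta i.1.
  by rewrite sum_primitive_pairs.
apply: (@le_trans _ _ (M ^+ 2 + M)); last first.
  by have := mulr_ge0 (ltW eta0) (sqr_ge0 M); lra.
rewrite expr2 {1}M_E [X in _ <= _ + X]M_E mulr_suml -big_split /=.
rewrite big_seq [leRHS]big_seq; apply: ler_sum => i iN.
have pi := primitive_pairsP _ _ iN.
have d0 j : 0 <= delta j := ltW (@diam_gt0 _ _ r0 j).
have le_pair j : j \in primitive_pairs N ->
    1 * 1 * fine ((U \x U)%E (form_event i `&` form_event j)) <=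
    delta i.1 * delta j.1 + (if j == i then delta i.1 else 0).
  move=> /primitive_pairsP pj; rewrite 2!mul1r.
  have [->|ij] := eqVneq j i; last first.
    by rewrite form_event_indep 1?eq_sym // addr0.
  by rewrite setIid form_event_prob // lerDr mulr_ge0.
apply: (@le_trans _ _ (\sum_(j <- primitive_pairs N)
    (delta i.1 * delta j.1 + (if j == i then delta i.1 else 0)))).
  by rewrite big_seq [leRHS]big_seq; apply: ler_sum => j /le_pair.
rewrite big_split /= -mulr_sumr -M_E lerD2l.
rewrite (bigD1_seq i) ?primitive_pairs_uniq //= eqxx.
by rewrite big1 ?addr0 // => j /negbTE ->.
Qed.

End LinearForms.

(** * Multiples of a point, for (n, m) = (1, 2) *)

Section Multiples.
Context {R : realType} (r : nat -> R).
Hypothesis r0 : forall q, 0 < r q.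
Local Notation U := (@unit_prob R).
Local Notation delta := (diam r).

Definition multiple_event (c : nat -> R) (q : nat) : set R :=
  [set t | periodic_ball (c q) (delta q / 2) (q%:R * t)].

Lemma multiple_event_indic c q t :
  \1_(multiple_event c q) t = pball_indic (c q) (delta q / 2) (q%:R * t) :> R.
Proof. exact: indic_congr. Qed.

Lemma measurable_multiple_event c q : measurable (multiple_event c q).
Proof.
rewrite (_ : multiple_event c q = setT `&`
    ( *%R (q%:R : R)) @^-1` periodic_ball (c q) (delta q / 2)).
  apply: mulrl_measurable => //; exact: measurable_periodic_ball.
by rewrite setTI.
Qed.

Lemma multiple_event_prob c q : (0 < q)%N ->
  U (multiple_event c q) = (delta q)%:E.
Proof.
move=> q0; have mE := measurable_multiple_event c q.
rewrite (@measure_integral_indic _ _ _ U _ mE).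
under eq_integral do rewrite multiple_event_indic.
by rewrite integral_unit_pball_dilate ?half_diam_itv // mulrC divfK.
Qed.

(** Apply [integral_pball_overlap] to q = a g and q' = b g, where a = q/g and b = q'/g are coprime
    and 1/a = g/q. *)
Lemma multiple_event_overlap c q q' : (0 < q)%N -> (0 < q')%N ->
  fine (U (multiple_event c q `&` multiple_event c q')) <=
  delta q * delta q' + delta q * (gcdn q' q)%:R / q%:R.
Proof.
move=> q0 q'0; set g := gcdn q' q.
have mE := measurableI _ _ (measurable_multiple_event c q)
  (measurable_multiple_event c q').
have g0 : (0 < g)%N by rewrite gcdn_gt0 q'0.
have qE : q = (q %/ g * g)%N by rewrite divnK // dvdn_gcdr.
have q'E : q' = (q' %/ g * g)%N by rewrite divnK // dvdn_gcdl.
have a0 : (0 < q %/ g)%N by rewrite divn_gt0 // dvdn_leq // dvdn_gcdr.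
have cab : coprime (q %/ g) (q' %/ g).
  rewrite /coprime -(eqn_pmul2r g0) muln_gcdl -qE -q'E mul1n.
  by rewrite gcdnC.
rewrite -lee_fin fineK ?fin_num_measure // (@measure_integral_indic _ _ _ U _ mE).
under eq_integral do rewrite indicI /= !multiple_event_indic.
have [rho0 _] := andP (half_diam_itv _ r0 q').
have := @integral_pball_overlap _ _ _ _ (c q) _ (c q') _ a0 g0 cab
  (half_diam_itv _ r0 q) rho0.
rewrite -qE -q'E => /le_trans; apply.
have -> : (q %/ g)%:R^-1 = g%:R / q%:R :> R.
  rewrite [X in _ / X%:R]qE natrM; field.
  by apply/andP; split; rewrite pnatr_eq0 -lt0n.
by rewrite lee_fin !(mulrC 2) !divfK // mulrDr mulrA.
Qed.

Variables c0 c1 : nat -> R.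

(** A product, since a max-norm ball constrains the two coordinates separately. *)
Definition point_event (q : nat) : set (R * R) :=
  multiple_event c0 q `*` multiple_event c1 q.

Lemma measurable_point_event q : measurable (point_event q).
Proof. by apply: measurableX; exact: measurable_multiple_event. Qed.

Lemma point_event_prob q : (0 < q)%N ->
  (U \x U)%E (point_event q) = (delta q ^+ 2)%:E.
Proof.
move=> q0; have m0 := measurable_multiple_event c0 q.
have m1 := measurable_multiple_event c1 q.
apply: (eq_trans (@product_measure1E _ _ _ _ R U U _ _ m0 m1)).
by rewrite expr2 EFinM; congr (_ * _)%E; exact: multiple_event_prob.
Qed.

Lemma point_event_overlap q q' : (0 < q)%N -> (0 < q')%N ->
  fine ((U \x U)%E (point_event q `&` point_event q')) <=
  (delta q * delta q' + delta q * (gcdn q' q)%:R / q%:R) ^+ 2.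
Proof.
move=> q0 q'0.
have m0 := measurableI _ _ (measurable_multiple_event c0 q)
  (measurable_multiple_event c0 q').
have m1 := measurableI _ _ (measurable_multiple_event c1 q)
  (measurable_multiple_event c1 q').
rewrite /point_event -setXI.
rewrite (@product_measure1E _ _ _ _ R U U _ _ m0 m1).
rewrite fineM ?fin_num_measure // expr2.
by apply: ler_pM; rewrite ?fine_ge0 // multiple_event_overlap.
Qed.

(** The difference of the two sides is eta (x - y/eta)^2. *)
Lemma sqrD_le (x y eta : R) : 0 < eta ->
  (x + y) ^+ 2 <= (1 + eta) * x ^+ 2 + (1 + eta^-1) * y ^+ 2.
Proof.
move=> eta0; rewrite -subr_ge0.
rewrite (_ : _ - _ = eta * (x - y / eta) ^+ 2); last by field; rewrite gt_eqF.
by rewrite mulr_ge0 ?sqr_ge0 // ltW.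
Qed.

Let weight (q : nat) : R := (totient q)%:R / q%:R.

(** The squared error of the overlap bound, kept only when the denominator averaged over is the
    larger one. *)
Let cross (q q' : nat) : R :=
  if (q' <= q)%N then (delta q * (gcdn q' q)%:R / q%:R) ^+ 2 else 0.

Let weight_ge0 q : 0 <= weight q.
Proof. by rewrite divr_ge0. Qed.

(** For fixed [q], the factor delta^2/q^2 comes out, and [sum_gcd_sqr_le] bounds what remains by
    q^2. *)
Let sum_cross N :
  \sum_(1 <= q < N) \sum_(1 <= q' < N) weight q * weight q' * cross q q' <=
  \sum_(1 <= q < N) weight q * delta q ^+ 2.
Proof.
apply: ler_sum_nat => q /andP[q0 qN].
have qR : 0 < q%:R :> R by rewrite ltr0n.
apply: (@le_trans _ _ (weight q * (delta q ^+ 2 / q%:R ^+ 2) *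
    \sum_(1 <= q' < q.+1) weight q' * (gcdn q' q)%:R ^+ 2)).
  rewrite (big_nat_widen 1 q.+1 N) // mulr_sumr [leRHS]big_mkcond /=.
  apply: ler_sum => q' _; rewrite /cross ltnS; case: ifP => _; rewrite ?mulr0 //.
  by rewrite le_eqVlt; apply/orP; left; apply/eqP; field; rewrite gt_eqF.
rewrite -mulrA ler_wpM2l // -mulrA ler_piMr ?sqr_ge0 //.
by rewrite mulrC ler_pdivrMr ?exprn_gt0 // mul1r; exact: sum_gcd_sqr_le.
Qed.

Lemma points_infinitely_often :
  (forall L, exists N, L <= \sum_(1 <= q < N) (totient q)%:R / q%:R * delta q ^+ 2) ->
  (U \x U)%E [set z | infinite_set [set q | point_event q z]] = 1%E.
Proof.
move=> unb.
have sumP N : \sum_(q <- index_iota 1 N) weight q * fine ((U \x U)%E (point_event q)) =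
    \sum_(1 <= q < N) weight q * delta q ^+ 2.
  by rewrite big_nat [RHS]big_nat; apply: eq_bigr => q /andP[q0 _];
    rewrite point_event_prob.
apply: (@infinitely_often_as _ _ R (U \x U)%E _ point_event weight _ _ (index_iota 1)) => //.
- exact: measurable_point_event.
- by move=> q; exact: totient_ratio_le1.
- by move=> N; exact: iota_uniq.
- by move=> L; have [N LN] := unb L; exists N; rewrite sumP.
(* The factor [1 + eta^-1] comes from [sqrD_le]; the 2 counts both orders of a pair, each handled by
   [sum_cross]. *)
move=> eta eta0; exists ((1 + eta^-1) * 2) => N; rewrite sumP.
set M := \sum_(1 <= q < N) _.
pose C := 1 + eta^-1.
have C0 : 0 <= C by rewrite addr_ge0 // invr_ge0 ltW.
have le_pair q q' : (0 < q)%N -> (0 < q')%N ->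
    fine ((U \x U)%E (point_event q `&` point_event q')) <=
    (1 + eta) * (delta q ^+ 2 * delta q' ^+ 2) + C * (cross q q' + cross q' q).
  have cross_ge0 k l : 0 <= cross k l by rewrite /cross; case: ifP; rewrite ?sqr_ge0.
  (* The intersection is symmetric, so the larger index can always be put first. *)
  move=> q0 q'0; have [q'q|/ltnW qq'] := leqP q' q.
    apply: (le_trans (point_event_overlap _ _ q0 q'0)).
    apply: (le_trans (sqrD_le _ _ _ eta0)).
    by rewrite -exprMn lerD2l ler_wpM2l // {1}/cross q'q lerDl.
  rewrite setIC; apply: (le_trans (point_event_overlap _ _ q'0 q0)).
  apply: (le_trans (sqrD_le _ _ _ eta0)).
  by rewrite -exprMn (mulrC (delta q')) lerD2l ler_wpM2l // {2}/cross qq' lerDr.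
apply: (@le_trans _ _ (\sum_(1 <= q < N) \sum_(1 <= q' < N) (
    (1 + eta) * ((weight q * delta q ^+ 2) * (weight q' * delta q' ^+ 2)) +
    C * (weight q * weight q' * cross q q' + weight q' * weight q * cross q' q)))).
  apply: ler_sum_nat => q /andP[q0 _].
  apply: ler_sum_nat => q' /andP[q'0 _].
  have := ler_wpM2l (mulr_ge0 (weight_ge0 q) (weight_ge0 q')) (le_pair _ _ q0 q'0).
  by move=> /le_trans; apply; rewrite le_eqVlt; apply/orP; left; apply/eqP; ring.
under eq_bigr do rewrite big_split /= -!mulr_sumr big_split /=.
rewrite big_split /= -!mulr_sumr -mulr_suml -expr2 lerD2l.
rewrite big_split /= [X in _ + X]exchange_big /= -mulrA ler_wpM2l //.
rewrite mulrC mulr_natr mulr2n lerD //; exact: sum_cross.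
Qed.

End Multiples.

(** * Assembly *)

Lemma probability_setI1 d (T : measurableType d) (R : realType)
    (P : probability T R) (A B : set T) : measurable A -> measurable B ->
  P A = 1%E -> P B = 1%E -> P (A `&` B) = 1%E.
Proof.
move=> mA mB PA PB.
have mAB : measurable (~` A `|` ~` B) by apply: measurableU; exact: measurableC.
have P0 : P (~` A `|` ~` B) = 0%E.
  apply/eqP; rewrite eq_le measure_ge0 andbT.
  apply: (@le_trans _ _ (P (~` A) + P (~` B))%E).
    by apply: measureU2; exact: measurableC.
  by rewrite !probability_setC // PA PB subee // adde0.
by rewrite -[A `&` B]setCK setCI probability_setC // P0 sube0.
Qed.

Section Assembly.
Context {R : realType}.
Local Notation U := (@unit_prob R).

(** Shows each coordinate as a linear form in [z] uniformly in the shape of the matrix; the first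
    sum is empty when [j] is nonzero. *)
Lemma mat_of_pair_linear (n m : nat) (q : 'rV[int]_n) (z : R * R) (j : 'I_m) :
  (map_mx intr q *m mat_of_pair n m z) ord0 j =
  (\sum_(i < n | (i + j == 0)%N) (q ord0 i)%:~R) * z.1 +
  (\sum_(i < n | (i + j != 0)%N) (q ord0 i)%:~R) * z.2.
Proof.
rewrite mxE (bigID (fun i : 'I_n => (i + j == 0)%N)) /= !mulr_suml.
congr (_ + _); apply: eq_bigr => i h; rewrite !mxE; first by rewrite h.
by rewrite (negbTE h).
Qed.

Lemma measurable_solutions (n m : nat) (c : 'rV[R]_m) (rho : R)
    (p : 'rV[int]_m) (q : 'rV[int]_n) :
  measurable [set z : R * R | q != 0 /\
    in_maxball c rho (map_mx intr q *m mat_of_pair n m z + map_mx intr p)].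
Proof.
have [->|q0] := eqVneq q 0.
  by rewrite (_ : [set z | _] = set0) //; apply/seteqP; split => // z [].
pose a (j : 'I_m) : R := \sum_(i < n | (i + j == 0)%N) (q ord0 i)%:~R.
pose b (j : 'I_m) : R := \sum_(i < n | (i + j != 0)%N) (q ord0 i)%:~R.
pose I j := `](c ord0 j - (p ord0 j)%:~R - rho), (c ord0 j - (p ord0 j)%:~R + rho)[%classic.
(* A finite intersection of strips, expressed through complements and a union. *)
rewrite (_ : [set z | _] =
    ~` \bigcup_(j : 'I_m) ~` [set z : R * R | I j (a j * z.1 + b j * z.2)]).
  apply: measurableC; apply: countable_bigcupT_measurable => [|j].
    exact: countableP.
  apply: measurableC.
  rewrite (_ : [set z | _] = setT `&`
    (fun z : R * R => a j * z.1 + b j * z.2) @^-1` I j).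
    by apply: measurable_linear => //; exact: measurable_itv.
  by rewrite setTI.
have IP z j : I j (a j * z.1 + b j * z.2) <->
    `|(map_mx intr q *m mat_of_pair n m z + map_mx intr p) ord0 j - c ord0 j| < rho.
  by rewrite mxE mat_of_pair_linear mxE /I /= in_itv /= ltr_norml -/(a j) -/(b j); split; lra.
apply/seteqP; split => z /=.
  by move=> [_ hz] [j _]; apply; apply/IP; exact: hz.
by move=> hz; split => // j; apply/IP; apply: contrapT => nI; apply: hz; exists j.
Qed.

(** The set in question is the unit square intersected with a measurable limsup set. It has measure
    at most 1, and it contains the intersection of the square with [L], both of full measure. *)
Lemma approx_set_full (n m : nat) (c : nat -> 'rV[R]_m) (r : nat -> R)
    (L : set (R * R)) :
  (forall z : R * R, (forall i j, 0 <= mat_of_pair n m z i j <= 1) <->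
     (0 <= z.1 <= 1) /\ (0 <= z.2 <= 1)) ->
  measurable L -> (U \x U)%E L = 1%E ->
  (forall z, L z -> infinite_set [set pq : 'rV[int]_m * 'rV[int]_n |
        (pq.2 != 0)%R /\
        in_maxball (c (supnorm_int pq.2)) (r (supnorm_int pq.2))
          (map_mx intr pq.2 *m mat_of_pair n m z + map_mx intr pq.1)]) ->
  lebesgue2 [set z : R * R | approx_set n m c r (mat_of_pair n m z)] = 1%E.
Proof.
move=> squareP mL L1 Linf; set Z := [set z | _].
pose sq : set (R * R) := `[0, 1]%classic `*` `[0, 1]%classic.
have msq : measurable sq by apply: measurableX; exact: measurable_itv.
pose W := [set z : R * R | infinite_set [set pq : 'rV[int]_m * 'rV[int]_n |
        (pq.2 != 0)%R /\
        in_maxball (c (supnorm_int pq.2)) (r (supnorm_int pq.2))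
          (map_mx intr pq.2 *m mat_of_pair n m z + map_mx intr pq.1)]].
have mW : measurable W.
  apply: (@measurable_limsup _ _ _ (fun pq : 'rV[int]_m * 'rV[int]_n =>
    [set z : R * R | pq.2 != 0 /\
      in_maxball (c (supnorm_int pq.2)) (r (supnorm_int pq.2))
          (map_mx intr pq.2 *m mat_of_pair n m z + map_mx intr pq.1)])).
  by move=> pq; exact: measurable_solutions.
have ZE : Z = sq `&` W.
  apply/seteqP; split => z [] h1 h2; split => //.
    by move/squareP: h1 => [z1 z2]; split; rewrite /= in_itv.
  by apply/squareP; move: h1 => [] /=; rewrite !in_itv.
have mZ : measurable Z by rewrite ZE; exact: measurableI.
rewrite lebesgue2_unit_square //; last by move=> z [/squareP].
have sq1 : (U \x U)%E sq = 1%E.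
  rewrite -lebesgue2_unit_square //.
  have m01 : measurable (`[0%R, 1%R]%classic : set R) by exact: measurable_itv.
  apply: (eq_trans (@product_measure1E _ _ _ _ R lebesgue_measure lebesgue_measure _ _ m01 m01)).
  have l01 : @lebesgue_measure R `[0%R, 1%R]%classic = 1%E.
    by rewrite lebesgue_measure_itv /= lte_fin ltr01 oppr0 adde0.
  by transitivity (1%:E * 1%:E : \bar R)%E; [congr (_ * _)%E; exact: l01|rewrite mule1].
apply/eqP; rewrite eq_le; apply/andP; split.
  rewrite -sq1 ZE; apply: le_measure; rewrite ?inE //.
  by apply: measurableI.
have <- : (U \x U)%E (sq `&` L) = 1%E by exact: probability_setI1.
apply: le_measure; rewrite ?inE //; first exact: measurableI.
by rewrite ZE => z [sqz Lz]; split => //; exact: Linf.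
Qed.

End Assembly.

(** * The two matrix shapes *)

Lemma supnorm_int1 (q : 'rV[int]_1) : supnorm_int q = `|q ord0 ord0|%N.
Proof. by rewrite /supnorm_int big_ord_recl big_ord0 maxn0. Qed.

Lemma supnorm_int2 (q : 'rV[int]_2) :
  supnorm_int q = maxn `|q ord0 ord0|%N `|q ord0 (lift ord0 ord0)|%N.
Proof. by rewrite /supnorm_int !big_ord_recl big_ord0 maxn0. Qed.

(** A number in (0, 1] does not grow when raised to a power at least 1. Divergence with exponent
    [1 + eps] thus gives divergence with exponent 1. *)
Lemma totient_ratio_powR_le (R : realType) (eps : R) (q : nat) : 0 < eps ->
  ((totient q)%:R / q%:R) `^ (1 + eps) <= (totient q)%:R / q%:R :> R.
Proof.
move=> eps0; have [->|q0] := posnP q.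
  by rewrite invr0 mulr0 powR0 // gt_eqF // addr_gt0.
apply: ge1r_powR; last by rewrite lerDl ltW.
by rewrite divr_gt0 ?ltr0n ?totient_gt0 // totient_ratio_le1.
Qed.

Section Cases.
Context {R : realType} (r : nat -> R) (eps : R).
Hypothesis r0 : forall q, 0 < r q.
Hypothesis eps0 : 0 < eps.

Lemma linear_forms_case (c : nat -> 'rV[R]_1) :
  (\sum_(1 <= q <oo)
     ((q%:R ^+ (2 - 1) * ((totient q)%:R / q%:R) `^ (1 + eps)
        * torus_ball_vol 1 (r q))%:E) = +oo)%E ->
  lebesgue2 [set z : R * R | approx_set 2 1 c r (mat_of_pair 2 1 z)] = 1%E.
Proof.
move=> div; pose c0 q := c q ord0 ord0.
have unb : forall L, exists N, L <= \sum_(1 <= q < N) (totient q)%:R * diam r q.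
  apply: nneseries_unbounded div => q.
    by rewrite !mulr_ge0 ?powR_ge0 // exprn_ge0 // ltW // diam_gt0.
  rewrite /torus_ball_vol expr1 subSS subn0 expr1.
  apply: (ler_wpM2r (ltW (diam_gt0 _ r0 q))).
  have [->|q0] := posnP q; first by rewrite mul0r ler0n.
  rewrite (le_trans (ler_wpM2l _ (totient_ratio_powR_le _ _ q eps0))) //.
  by rewrite mulrC divfK // pnatr_eq0 -lt0n.
have full := forms_infinitely_often c0 r r0 unb.
apply: (approx_set_full _ _ _ _ _ _ _ full).
- move=> z; split=> [h|[z1 z2] i j].
    by have := h ord0 ord0; have := h (lift ord0 ord0) ord0; rewrite !mxE.
  by rewrite mxE; case: ifP.
- by apply: measurable_limsup; exact: measurable_form_event.
move=> z inf_i fin_pq; apply: inf_i.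
(* This map recovers the primitive pair from a solution, so finitely many solutions could come from
   only finitely many pairs. *)
pose f (pq : 'rV[int]_1 * 'rV[int]_2) : nat * nat :=
  (`|pq.2 ord0 (lift ord0 ord0)|%N, `|pq.2 ord0 ord0|%N).
apply: sub_finite_set (finite_image f fin_pq) => -[Q k] [/and3P[/= Q0 kQ _] [p hp]].
(* As [k < Q], this vector has sup norm [Q], so the ball involved is the one of index [Q]. *)
pose v : 'rV[int]_2 := \row_j (if j == ord0 then k%:Z else Q%:Z).
have v0 : v ord0 ord0 = k%:Z by rewrite mxE.
have v1 : v ord0 (lift ord0 ord0) = Q%:Z by rewrite mxE.
have normv : supnorm_int v = Q.
  by rewrite supnorm_int2 v0 v1 /=; apply/maxn_idPr; exact: ltnW.
exists (const_mx p, v); last by rewrite /f /= v0 v1.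
split=> /=.
  by apply/eqP => /rowP/(_ (lift ord0 ord0)); rewrite v1 mxE; lia.
rewrite normv => j; have -> : j = ord0 by rewrite [LHS]ord1.
rewrite mxE mat_of_pair_linear.
rewrite (big_pred1 ord0) ?(big_pred1 (lift ord0 ord0)); last 2 first.
- by move=> i; case: (unliftP ord0 i) => [k' ->|->] //; rewrite ord1.
- by move=> i; case: (unliftP ord0 i) => [k' ->|->] //; rewrite ord1.
rewrite v0 v1 !mxE; apply: lt_le_trans (half_diam_le r Q).
by rewrite -!pmulrn.
Qed.

Lemma points_case (c : nat -> 'rV[R]_2) :
  (\sum_(1 <= q <oo)
     ((q%:R ^+ (1 - 1) * ((totient q)%:R / q%:R) `^ (1 + eps)
        * torus_ball_vol 2 (r q))%:E) = +oo)%E ->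
  lebesgue2 [set z : R * R | approx_set 1 2 c r (mat_of_pair 1 2 z)] = 1%E.
Proof.
move=> div; pose c0 q := c q ord0 ord0; pose c1 q := c q ord0 (lift ord0 ord0).
have unb : forall L, exists N,
    L <= \sum_(1 <= q < N) (totient q)%:R / q%:R * diam r q ^+ 2.
  apply: nneseries_unbounded div => q.
    apply: mulr_ge0; first by rewrite mulr_ge0 ?powR_ge0 ?exprn_ge0.
    by apply: exprn_ge0; exact: ltW (diam_gt0 _ r0 q).
  rewrite /torus_ball_vol subnn expr0 mul1r ler_wpM2r ?sqr_ge0 //.
  exact: totient_ratio_powR_le.
have full := points_infinitely_often r r0 c0 c1 unb.
apply: (approx_set_full _ _ _ _ _ _ _ full).
- move=> z; split=> [h|[z1 z2] i j].
    by have := h ord0 ord0; have := h ord0 (lift ord0 ord0); rewrite !mxE.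
  by rewrite mxE; case: ifP.
- by apply: measurable_limsup; exact: measurable_point_event.
move=> z inf_i fin_pq; apply: inf_i.
pose f (pq : 'rV[int]_2 * 'rV[int]_1) : nat := `|pq.2 ord0 ord0|%N.
(* The index 0 is adjoined because [point_event 0] may hold although q = 0 gives no admissible
   solution. *)
have fin0 : finite_set ([set 0%N] `|` f @` [set pq : 'rV[int]_2 * 'rV[int]_1 |
    (pq.2 != 0)%R /\ in_maxball (c (supnorm_int pq.2)) (r (supnorm_int pq.2))
      (map_mx intr pq.2 *m mat_of_pair 1 2 z + map_mx intr pq.1)]).
  by rewrite finite_setU; split; [exact: finite_set1|exact: finite_image].
apply: sub_finite_set fin0 => q [[p hp] [p' hp']].
have [->|q0] := posnP q; first by left.
right; pose v : 'rV[int]_1 := const_mx q%:Z.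
(* The two coordinate events supply the integer vector one entry at a time. *)
exists (\row_j (if j == ord0 then p else p'), v); last by rewrite /f /= mxE.
split=> /=.
  by apply/eqP => /rowP/(_ ord0); rewrite !mxE; lia.
rewrite supnorm_int1 mxE absz_nat => j; apply: lt_le_trans (half_diam_le r q).
rewrite mxE mat_of_pair_linear.
case: (unliftP ord0 j) => [j' ->|->].
  rewrite big_pred0 ?(big_pred1 ord0); last 2 first.
  - by move=> i; rewrite [i]ord1.
  - by move=> i; rewrite [i]ord1.
  by rewrite !mxE mul0r add0r -pmulrn [j']ord1.
rewrite (big_pred1 ord0) ?big_pred0; last 2 first.
- by move=> i; rewrite [i]ord1.
- by move=> i; rewrite [i]ord1.
by rewrite !mxE mul0r addr0 -pmulrn.
Qed.

End Cases.

Theorem mainTheorem14 (R : realType) (n m : nat) (eps : R)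
  (c : nat -> 'rV[R]_m) (r : nat -> R) :
  (1 <= n)%N -> (1 <= m)%N -> (n * m = 2)%N -> 0 < eps ->
  (forall q, 0 < r q) ->
  (\sum_(1 <= q <oo)
     ((q%:R ^+ (n - 1) * ((totient q)%:R / q%:R) `^ (1 + eps)
        * torus_ball_vol m (r q))%:E) = +oo)%E ->
  lebesgue2 [set z : R * R | approx_set n m c r (mat_of_pair n m z)] = 1%E.
Proof.
(* Only the shapes (1, 2) and (2, 1) satisfy [n * m = 2]. *)
case: n => [|[|[|n]]] // _; case: m c => [|[|[|m]]] // c _ nm eps0 r0 div;
  try by exfalso; move: nm; nia.
- exact: points_case div.
- exact: linear_forms_case div.
Qed.
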